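(* Let $G$ be a finite group, $\theta\in\mathrm{Aut}(G)$ and $t$ a positive integer. The following are equivalent: (i) $(G,1,\theta)$ is superfaithful and $t$ and $|\mathrm{Fix}(\theta)|$ are coprime. (ii) $(G,t,\theta)$ is superfaithful.
   Context: A quandle is an algebra $(Q,*,\backslash)$ satisfying $x\backslash(x*y)=y=x*(x\backslash y)$ (so every left multiplication $L_a:b\mapsto a*b$ is a bijection), $x*(y*z)=(x*y)*(x*z)$ and $x*x=x$. $Q$ is faithful if $L_a=L_b$ implies $a=b$, and superfaithful if every subalgebra (subset closed under $*$ and $\backslash$) is faithful. For a group $K$, $f\in\mathrm{Aut}(K)$ and a subgroup $H\le \mathrm{Fix}(f)=\{a\in K: f(a)=a\}$, the coset quandle $\mathcal Q(K,H,f)$ is the set $K/H$ of left cosets with $aH*bH=af(a^{-1}b)H$. For a group $G$, $\theta\in\mathrm{Aut}(G)$ and $t\ge 1$, let $\theta_t:G^t\to G^t$, $(x_1,\dots,x_t)\mapsto(\theta(x_t),x_1,x_2,\dots,x_{t-1})$; this is an automorphism of $G^t$ with $H_t=\mathrm{Fix}(\theta_t)=\{(a,a,\dots,a): a\in\mathrm{Fix}(\theta)\}$. The quandle $(G,t,\theta)$ is the coset quandle $\mathcal Q(G^t,H_t,\theta_t)$. In particular $(G,1,\theta)=\mathcal Q(G,\mathrm{Fix}(\theta),\theta)$. *)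

(* Defs.v *)
From HB Require Import structures.
From mathcomp Require Import all_boot all_fingroup.

Set Implicit Arguments.
Unset Strict Implicit.
Unset Printing Implicit Defensive.

Import GroupScope.

HB.mixin Record isQuandle Q := {
  qmul : Q -> Q -> Q;
  qldiv : Q -> Q -> Q;
  qmulK : forall x y, qldiv x (qmul x y) = y;
  qldivK : forall x y, qmul x (qldiv x y) = y;
  qmul_distl : forall x y z, qmul x (qmul y z) = qmul (qmul x y) (qmul x z);
  qmulxx : forall x, qmul x x = x
}.

#[short(type="quandleType")]
HB.structure Definition Quandle := { Q of isQuandle Q }.

Definition subquandle (Q : quandleType) (S : Q -> Prop) : Prop :=
  forall x y, S x -> S y -> S (qmul x y) /\ S (qldiv x y).

(* For a subalgebra S, the left multiplications compared are those of S,
   i.e. they are regarded as maps S -> S. *)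
Definition faithful_on (Q : quandleType) (S : Q -> Prop) : Prop :=
  forall a b, S a -> S b -> (forall x, S x -> qmul a x = qmul b x) -> a = b.

Definition superfaithful (Q : quandleType) : Prop :=
  forall S : Q -> Prop, subquandle S -> faithful_on S.

Section CosetQuandle.

Variables (K : finGroupType) (H : {group K}) (f : {perm K}).
Hypotheses (fA : f \in Aut [set: K]) (sHF : H \subset 'Fix_'P[f]).

Definition coset_quandle of f \in Aut [set: K] & H \subset 'Fix_'P[f] : Type :=
  {A : {set K} | A \in lcosets H [set: K]}.

Local Notation cosetQ := (coset_quandle fA sHF).

Lemma lcoset_in (a : K) : a *: H \in lcosets H [set: K].
Proof. by apply/lcosetsP; exists a; rewrite ?inE. Qed.

Definition lcosetQ (a : K) : cosetQ := exist _ (a *: H) (lcoset_in a).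

Definition reprQ (A : cosetQ) : K := repr (sval A).

Definition cosetQ_mul (A B : cosetQ) : cosetQ :=
  lcosetQ (reprQ A * f ((reprQ A)^-1 * reprQ B)).

Definition cosetQ_ldiv (A B : cosetQ) : cosetQ :=
  lcosetQ (reprQ A * f^-1 ((reprQ A)^-1 * reprQ B)).

Lemma autT_M (g : {perm K}) :
  g \in Aut [set: K] -> {morph g : x y / x * y}.
Proof. by move=> gA x y; apply: (morphicP (Aut_morphic gA)); rewrite ?inE. Qed.

Lemma autT_V (g : {perm K}) : g \in Aut [set: K] -> {morph g : x / x^-1}.
Proof.
move=> gA x; apply: (mulgI (g x)); rewrite mulgV -(autT_M gA) mulgV.
by apply: (mulgI (g 1)); rewrite -(autT_M gA) !mulg1.
Qed.

Lemma fix_H h : h \in H -> f h = h.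
Proof. by move/(subsetP sHF)/afix1P. Qed.

Lemma fixV_H h : h \in H -> f^-1 h = h.
Proof. by move=> /fix_H {1}<-; rewrite permK. Qed.

Lemma lcosetQ_eq a b : a^-1 * b \in H -> lcosetQ a = lcosetQ b.
Proof. by move=> Hab; apply: val_inj; apply/lcoset_eqP; rewrite mem_lcoset groupVl // invMg invgK. Qed.

Lemma reprQ_lcosetQ a : exists2 h, h \in H & reprQ (lcosetQ a) = a * h.
Proof.
have : repr (a *: H) \in a *: H by apply: (mem_repr a); rewrite lcoset_refl.
by move=> /lcosetP[h Hh e]; exists h.
Qed.

Lemma reprQK : cancel reprQ lcosetQ.
Proof.
move=> A; case: (A) => B HB; case/lcosetsP: (HB) => a _ eB.
apply: val_inj => /=; rewrite /reprQ /= eB.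
apply/lcoset_eqP; apply: (mem_repr a); exact: lcoset_refl.
Qed.

Lemma cosetQP (A : cosetQ) : exists a, A = lcosetQ a.
Proof. by exists (reprQ A); rewrite reprQK. Qed.

(* The operations do not depend on the chosen representatives. *)
Lemma cosetQ_mulE a b :
  cosetQ_mul (lcosetQ a) (lcosetQ b) = lcosetQ (a * f (a^-1 * b)).
Proof.
rewrite /cosetQ_mul; have [h Hh ->] := reprQ_lcosetQ a.
have [k Hk ->] := reprQ_lcosetQ b; apply: lcosetQ_eq.
have -> : f ((a * h)^-1 * (b * k)) = h^-1 * f (a^-1 * b) * k.
  by rewrite invMg !(autT_M fA) !(autT_V fA) (fix_H Hh) (fix_H Hk) !mulgA.
by rewrite !mulgA mulgK invMg -!mulgA mulVg mulg1 groupV.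
Qed.

Lemma cosetQ_ldivE a b :
  cosetQ_ldiv (lcosetQ a) (lcosetQ b) = lcosetQ (a * f^-1 (a^-1 * b)).
Proof.
have fVA : f^-1 \in Aut [set: K] by rewrite groupV.
rewrite /cosetQ_ldiv; have [h Hh ->] := reprQ_lcosetQ a.
have [k Hk ->] := reprQ_lcosetQ b; apply: lcosetQ_eq.
have -> : f^-1 ((a * h)^-1 * (b * k)) = h^-1 * f^-1 (a^-1 * b) * k.
  by rewrite invMg !(autT_M fVA) !(autT_V fVA) (fixV_H Hh) (fixV_H Hk) !mulgA.
by rewrite !mulgA mulgK invMg -!mulgA mulVg mulg1 groupV.
Qed.

Lemma cosetQ_mulK x y : cosetQ_ldiv x (cosetQ_mul x y) = y.
Proof.
have [[a ->] [b ->]] := (cosetQP x, cosetQP y).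
by rewrite cosetQ_mulE cosetQ_ldivE mulKg permK mulKVg.
Qed.

Lemma cosetQ_ldivK x y : cosetQ_mul x (cosetQ_ldiv x y) = y.
Proof.
have [[a ->] [b ->]] := (cosetQP x, cosetQP y).
by rewrite cosetQ_ldivE cosetQ_mulE mulKg permKV mulKVg.
Qed.

Lemma cosetQ_mul_distl x y z :
  cosetQ_mul x (cosetQ_mul y z) = cosetQ_mul (cosetQ_mul x y) (cosetQ_mul x z).
Proof.
have [[a ->] [[b ->] [c ->]]] := (cosetQP x, (cosetQP y, cosetQP z)).
rewrite !cosetQ_mulE; congr lcosetQ.
rewrite !(autT_M fA) !invMg !(autT_M fA) !(autT_V fA) ?invgK !mulgA.
by do !rewrite ?mulgKV ?mulgK.
Qed.

Lemma cosetQ_mulxx x : cosetQ_mul x x = x.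
Proof.
have [a ->] := cosetQP x; rewrite cosetQ_mulE mulVg.
by rewrite (fix_H (group1 H)) mulg1.
Qed.

HB.instance Definition _ := isQuandle.Build cosetQ
  cosetQ_mulK cosetQ_ldivK cosetQ_mul_distl cosetQ_mulxx.

End CosetQuandle.

Section FixGroup.

Variables (K : finGroupType) (f : {perm K}).

Lemma fix_group_set : f \in Aut [set: K] -> group_set 'Fix_'P[f].
Proof.
move=> fA; apply/group_setP; split.
  apply/afix1P; rewrite /= apermE; apply: (mulgI (f 1)).
  by rewrite -(autT_M fA) !mulg1.
move=> x y /afix1P/= fx /afix1P/= fy; apply/afix1P.
by rewrite /= apermE (autT_M fA) -!apermE fx fy.
Qed.

Definition fix_group (fA : f \in Aut [set: K]) : {group K} :=
  Group (fix_group_set fA).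

End FixGroup.

Section CyclicShift.

Variables (G : finGroupType) (t : nat) (theta : {perm G}).

(* The constant dependent product is used because it is {dffun _}, not
   {ffun _}, that carries the pointwise group structure. *)
Definition gpow : finGroupType := {dffun forall _ : 'I_t, G}.

(* Indices run over 0, ..., t-1 and ord_pred is the cyclic predecessor:
   the entry at 0 is theta applied to the last entry of x. *)
Definition shift_fun (x : gpow) : gpow :=
  [ffun i : 'I_t => if i == 0 :> nat then theta (x (ord_pred i))
                    else x (ord_pred i)].

Lemma shift_fun_inj : injective shift_fun.
Proof.
move=> x y /ffunP exy; apply/ffunP => i; have := exy (ordS i).
by rewrite !ffunE ordSK; case: ifP => // _ /perm_inj.
Qed.

Definition shift : {perm gpow} := perm shift_fun_inj.

Lemma shift_Aut : theta \in Aut [set: G] -> shift \in Aut [set: gpow].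
Proof.
move=> thA; rewrite inE; apply/andP; split.
  by apply/subsetP => x _; rewrite inE.
apply/morphicP => x y _ _; rewrite !permE; apply/ffunP => i.
by rewrite !ffunE; case: ifP => // _; rewrite (autT_M thA).
Qed.

Lemma shift_fixP (x : gpow) : 0 < t ->
  reflect (exists2 a, a \in 'Fix_'P[theta] & x = [ffun=> a])
          (x \in 'Fix_'P[shift]).
Proof.
move=> t0; apply: (iffP afix1P) => [|[a /afix1P/= ta ->]]; last first.
  rewrite /= apermE permE; apply/ffunP => i; rewrite !ffunE.
  by case: ifP => // _; rewrite -apermE.
rewrite /= apermE permE => /ffunP fx.
pose i0 := Ordinal t0.
have xc n (nt : n < t) : x (Ordinal nt) = x i0.
  elim: n nt => [|n IHn] nt; first by congr (x _); apply: val_inj.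
  rewrite -(IHn (ltnW nt)) -[LHS]fx ffunE /=; congr (x _); apply: val_inj.
  by rewrite /= modnDr modn_small // ltnW.
exists (x i0); last by apply/ffunP => -[n nt]; rewrite ffunE xc.
apply/afix1P; rewrite /= apermE -[RHS]fx ffunE /=.
have -> : ord_pred i0 = Ordinal (ltn_ord (ord_pred i0)) by apply: val_inj.
by rewrite [in RHS]xc.
Qed.

Variable thetaA : theta \in Aut [set: G].

(* The quandle (G, t, theta). *)
Definition shift_quandle : quandleType :=
  @coset_quandle gpow (fix_group (shift_Aut thetaA)) shift
    (shift_Aut thetaA) (subxx _).

End CyclicShift.

Arguments shift_quandle {G} t {theta} thetaA.

(* Main.v *)
Require Import Defs.
From mathcomp Require Import all_boot all_fingroup all_solvable.

(** Superfaithfulness is a condition on pairs: a quandle is superfaithful as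
    soon as [a * b = b] forces [a = b] ([superfaithfulP]).  In a coset quandle
    one may translate [a] to the base coset, so the condition reads
    [b^-1 * f b \in H -> b \in H] ([coset_superfaithfulP]).

    For [(G, t, theta)], suppose that [b^-1 * theta_t b] is the diagonal element
    [(h, ..., h)], with [h] fixed by [theta].  Going down the coordinates, [b] is
    determined by its last entry [c], each entry being the next one times [h],
    and closing the cycle gives [theta c = c * h ^+ t].  Conversely each such
    pair [(c, h)] comes from some [b], and [b] is fixed if and only if [h = 1].
    Hence [(G, t, theta)] is superfaithful if and only if, for [h] in
    [Fix theta],
      [theta c = c * h ^+ t] implies [h = 1]    ([shift_superfaithfulP]).

    The theorem compares this condition for [t] and for [1].  If [t] is coprime
    to the order of [Fix theta], then [h |-> h ^+ t] permutes [Fix theta] and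
    sends only [1] to [1], so that the two conditions agree.  Conversely the
    condition for [t], taken at [c = 1], says that [Fix theta] has no nontrivial
    element of order dividing [t], which by Cauchy's theorem is coprimality. *)

Set Implicit Arguments.
Unset Strict Implicit.
Unset Printing Implicit Defensive.

Import GroupScope.

Lemma qmulI (Q : quandleType) (x : Q) : injective (qmul x).
Proof. exact: can_inj (qmulK x). Qed.

(** If [L_a] and [L_b] agree on a subalgebra containing [a] and [b], then
    [a * b = b * b = b]; this gives one direction.  For the other, the fixed
    points of [L_a] form a subalgebra on which [a], and hence every [b * a] with
    [b] fixed, acts trivially; its faithfulness gives [b * a = a].  Then [{a, b}]
    is a subalgebra in which all left multiplications are the identity, and its
    faithfulness gives [a = b]. *)
Lemma superfaithfulP (Q : quandleType) :
  superfaithful Q <-> forall a b : Q, qmul a b = b -> a = b.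
Proof.
split=> [sfQ a b ab | fixQ S _ a b _ Sb eq_ab]; last first.
  by apply: fixQ; rewrite (eq_ab b Sb) qmulxx.
have subFix : subquandle (fun c => qmul a c = c).
  move=> x y ax ay; split; first by rewrite qmul_distl ax ay.
  by apply: (@qmulI Q x); rewrite -{1}ax -qmul_distl !qldivK.
have ba : qmul b a = a.
  apply: (sfQ _ subFix) => [||x ax]; last rewrite ax; rewrite ?qmulxx //.
    by rewrite qmul_distl ab qmulxx.
  have [_ az] := subFix b x ab ax.
  by rewrite -{1}(qldivK b x) -qmul_distl az qldivK.
pose S c := c = a \/ c = b.
have projS x y : S x -> S y -> qmul x y = y.
  by move=> [] -> [] ->; rewrite ?qmulxx.
apply: (sfQ S) => [x y Sx Sy | | | x Sx]; [|by left|by right|].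
  by rewrite -{2}(projS x y Sx Sy) qmulK projS.
by rewrite !projS //; [right | left].
Qed.

Lemma autT_1 (K : finGroupType) (f : {perm K}) :
  f \in Aut [set: K] -> f 1 = 1.
Proof. by move=> fA; apply: (mulgI (f 1)); rewrite -(autT_M fA) !mulg1. Qed.

Lemma lcosetQ_eqP (K : finGroupType) (H : {group K}) (f : {perm K})
    (fA : f \in Aut [set: K]) (sHF : H \subset 'Fix_'P[f]) (a b : K) :
  lcosetQ fA sHF a = lcosetQ fA sHF b <-> a^-1 * b \in H.
Proof.
split; last exact: lcosetQ_eq.
by move=> /(congr1 sval) /= eq_ab; rewrite -mem_lcoset eq_ab lcoset_refl.
Qed.

(** The products compared are [aH * bH = bH]; left translation by [a^-1] is an
    automorphism of the coset quandle, so only [1H * bH = bH] matters, that is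
    [f b \in bH]. *)
Lemma coset_superfaithfulP (K : finGroupType) (H : {group K}) (f : {perm K})
    (fA : f \in Aut [set: K]) (sHF : H \subset 'Fix_'P[f]) :
  superfaithful (coset_quandle fA sHF)
    <-> forall b : K, b^-1 * f b \in H -> b \in H.
Proof.
apply: iff_trans (superfaithfulP _) _; split=> [fixQ b Hb | fixK A B].
  have /lcosetQ_eqP : lcosetQ fA sHF 1 = lcosetQ fA sHF b.
    apply: fixQ; rewrite [LHS]cosetQ_mulE invg1 !mul1g; apply/lcosetQ_eqP.
    by rewrite -groupV invMg invgK.
  by rewrite invg1 mul1g.
have [[a ->] [b ->]] := (cosetQP A, cosetQP B).
rewrite [qmul _ _]cosetQ_mulE => /lcosetQ_eqP Hab; apply/lcosetQ_eqP/fixK.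
by rewrite -groupV invMg invgK mulgA in Hab; rewrite invMg invgK.
Qed.

(** With [shift b = b * (h, ..., h)] each entry of [b] is the next one times
    [h], while [theta] of the last entry is the first one times [h]. *)
Lemma shift_superfaithfulP (G : finGroupType) (theta : {perm G})
    (thetaA : theta \in Aut [set: G]) (t : nat) (t_gt0 : 0 < t) :
  superfaithful (shift_quandle t thetaA)
    <-> forall c h : G,
          h \in 'Fix_'P[theta] -> theta c = c * h ^+ t -> h = 1.
Proof.
apply: iff_trans (coset_superfaithfulP _ _) _ => /=.
case: t t_gt0 => // n t_gt0; split=> [fixK c h hF ch | fixG b].
  (* The only solution of the recursion with last entry [c]. *)
  pose b : gpow G n.+1 := [ffun i : 'I_n.+1 => c * h ^+ (n - i)].
  pose hh : gpow G n.+1 := [ffun=> h].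
  have shift_b : shift n.+1 theta b = b * hh.
    apply/ffunP => i; rewrite permE !ffunE -mulgA -expgSr.
    case: eqP => [i0 | /eqP i_neq0].
      by rewrite /= i0 add0n modn_small // subnn mulg1 subn0 ch.
    have i_gt0 : 0 < i by rewrite lt0n.
    have -> : ord_pred i = i.-1 :> nat.
      by rewrite /= -(prednK i_gt0) addSn /= modnDr modn_small // prednK // ltnW.
    by rewrite -subSn ?leq_ord // -{2}(prednK i_gt0) subSS.
  have /afix1P /= : b \in 'Fix_'P[shift n.+1 theta].
    apply: fixK; rewrite shift_b mulKg.
    by apply/shift_fixP => //; exists h.
  rewrite apermE shift_b => /(canRL (mulKg b)); rewrite mulVg.
  by move/ffunP/(_ ord0); rewrite !ffunE.
case/shift_fixP => // h hF /(canRL (mulKVg b)) shift_b.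
have shift_bE i : shift n.+1 theta b i = b i * h by rewrite shift_b !ffunE.
have b0E m (lt_mn : m < n.+1) : b ord0 = b (Ordinal lt_mn) * h ^+ m.
  elim: m lt_mn => [|m IHm] lt_mn.
    by rewrite mulg1; congr (b _); apply: val_inj.
  rewrite (IHm (ltnW lt_mn)) expgS mulgA -shift_bE permE ffunE /=.
  by congr (b _ * _); apply: val_inj; rewrite /= modnDr modn_small // ltnW.
have h1 : h = 1.
  apply: (fixG (b ord_max) h hF).
  have := shift_bE ord0; rewrite permE ffunE eqxx.
  have -> : ord_pred ord0 = ord_max :> 'I_n.+1.
    by apply: val_inj; rewrite /= modn_small.
  move=> ->; rewrite (b0E n (ltnSn n)) expgSr mulgA.
  by congr (b _ * _ * _); apply: val_inj.
apply/afix1P; rewrite /= apermE; apply/ffunP => i.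
by rewrite shift_bE h1 mulg1.
Qed.

(** A common prime divisor of [t] and [#|H|] would be, by Cauchy's theorem, the
    order of some element of [H]. *)
Lemma coprime_card_expg1 (gT : finGroupType) (H : {group gT}) (t : nat) :
  0 < t -> (forall h, h \in H -> h ^+ t = 1 -> h = 1) -> coprime t #|H|.
Proof.
move=> t_gt0 inj1; apply/negPn/negP => ncop.
have gcd_gt1 : 1 < gcdn t #|H|.
  by rewrite ltn_neqAle eq_sym ncop gcdn_gt0 t_gt0.
have p_pr := pdiv_prime gcd_gt1.
have := pdiv_dvd (gcdn t #|H|); rewrite dvdn_gcd => /andP[p_t p_H].
have [h hH oh] := Cauchy p_pr p_H.
have h1 : h = 1 by apply: inj1 => //; apply/eqP; rewrite -order_dvdn oh.
by rewrite -oh h1 order1 in p_pr.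
Qed.

Theorem proposition2p7 (G : finGroupType) (theta : {perm G})
    (thetaA : theta \in Aut [set: G]) (t : nat) (t_gt0 : 0 < t) :
  (superfaithful (shift_quandle 1 thetaA) /\ coprime t #|'Fix_'P[theta]%g|)
  <-> superfaithful (shift_quandle t thetaA).
Proof.
have [sf1E sf1I] := shift_superfaithfulP thetaA (ltnSn 0).
have [sftE sftI] := shift_superfaithfulP thetaA t_gt0.
pose F := fix_group thetaA; rewrite -[afix _ _]/(gval F).
split=> [[/sf1E sf1 cop] | /sftE sft].
  apply: sftI => c h hF ch; rewrite coprime_sym in cop.
  have ht : h ^+ t = 1 by apply: (sf1 c); rewrite ?(groupX (G := F)) ?expg1.
  by apply: (can_in_inj (expgK cop)); rewrite ?group1 // ht expg1n.
have cop : coprime t #|F|.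
  apply: coprime_card_expg1 => // h hF ht; apply: (sft 1) => //.
  by rewrite ht mulg1 (autT_1 thetaA).
split=> //; apply: sf1I => c h hF; rewrite expg1 => ch.
rewrite coprime_sym in cop.
(* A [t]-th root [k] of [h] in [Fix theta] brings in the condition for [t]. *)
pose k := h ^+ expg_invn F t.
have kt : k ^+ t = h by rewrite -expgM mulnC expgM (expgK cop).
rewrite -kt (sft c k) ?expg1n ?kt //; exact: (groupX (G := F)).
Qed.
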